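(* Let $A\in\mathbb{R}^{m\times n}$, $b\in\mathbb{R}^m$, $r\in\{0,1,\ldots,n-1\}$. Let $\phi:[0,\infty)\to\mathbb{R}$ be lower semi-continuous and increasing on $[0,\infty)$ with $\phi(0)=0$, and assume $\phi''(t)<0$ for all $t>0$. Define $$\mathcal{B}:=\{\mathcal{I}\subseteq\{1,\ldots,n\}:\ A_{\mathcal I}\text{ has full column rank and }(A_{\mathcal I})^Tb\ne0\},$$ $$\delta_{\mathcal I}:=\min\Big\{\big|[(A_{\mathcal I})^TA_{\mathcal I}]^{-1}(A_{\mathcal I})^Tb\big|_i:\ \big|[(A_{\mathcal I})^TA_{\mathcal I}]^{-1}(A_{\mathcal I})^Tb\big|_i>0,\ 1\le i\le|\mathcal I|\Big\}\quad\forall\,\mathcal I\in\mathcal B,$$ $$\delta:=\min\{\delta_{\mathcal I}:\mathcal I\in\mathcal B\}$$ (with the convention $\min\emptyset=+\infty$). Let $x^*$ be an arbitrary local minimizer of the problem $$\min_{x\in\mathbb{R}^n}\Big\{\sum_{i=r+1}^n\phi(|x|_{[i]}):\ Ax-b=0\Big\},$$ and let $K=\min\{\|x\|_0:Ax=b\}$. Then: (i) If $0\le r<K$, then $|x^*_i|\ge\delta$ for all $i$ with $x^*_i\neq0$. (ii) If $K\le r\le n-1$, then $x^*$ is $r$-sparse or $|x^*_i|\ge\delta$ for all $i$ with $x_i^*\ne0$.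
   Context: $|x|_{[i]}$ denotes the $i$th largest element of $\{|x_1|,\ldots,|x_n|\}$ (counted with multiplicity). $\|x\|_0$ is the number of nonzero entries of $x$; $x$ is $k$-sparse if $\|x\|_0\le k$. $A_{\mathcal I}$ is the submatrix formed by the columns of $A$ indexed by $\mathcal I$. For a vector $u$, $|u|$ is the vector of absolute values of its entries and $|u|_i$ its $i$th entry. ''Increasing'' is meant in the weak sense. *)

(* Defs.v *)
From mathcomp Require Import all_boot all_order all_algebra.
From mathcomp Require Import all_classical all_reals all_analysis.
Import Order.TTheory GRing.Theory Num.Theory.
Import numFieldNormedType.Exports.

Set Implicit Arguments.
Unset Strict Implicit.
Unset Printing Implicit Defensive.

Local Open Scope classical_set_scope.
Local Open Scope ring_scope.

Definition is_minimum d (T : porderType d) (S : set T) (k : T) : Prop :=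
  S k /\ lbound S k.

Definition local_minimizer (R : realType) (T : topologicalType) (f : T -> R)
    (S : set T) (x : T) : Prop :=
  S x /\ \forall y \near within S (nbhs x), f x <= f y.

Section SparseVectors.
Variables (R : realType) (n : nat).
Implicit Types (x : 'cV[R]_n) (phi : R -> R).

Definition l0norm x : nat := #|[set i | x i 0 != 0]%SET|.

(* The index i starts at 1, as in the usual notation |x|_[i]. *)
Definition abs_largest x (i : nat) : R :=
  nth 0 (sort (fun a c => c <= a) [seq `|x j 0| | j <- enum 'I_n]) i.-1.

Definition tail_penalty phi (r : nat) x : R :=
  \sum_(r.+1 <= i < n.+1) phi (abs_largest x i).

End SparseVectors.

(* phi : [0, oo) -> R is represented by a function on R, of which only the
   values on [0, oo) matter: semi-continuity is taken in the subspace topology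
   of [0, oo), where points outside [0, oo) are isolated and hence impose no
   condition. *)
Definition lsc_on_nonneg (R : realType) (phi : R -> R) : Prop :=
  lower_semicontinuous
    (fun t : subspace (`[0, +oo[ : set R) => (phi t)%:E).

Definition negative_second_derivative (R : realType) (phi : R -> R) : Prop :=
  forall t : R, 0 < t ->
    [/\ derivable phi t 1, derivable (derive1 phi) t 1 & derive1n 2 phi t < 0].

Section Delta.
Variables (R : realType) (m n : nat) (A : 'M[R]_(m, n)) (b : 'cV[R]_m).
Implicit Types I : {set 'I_n}.

Definition col_submx I : 'M[R]_(m, #|I|) :=
  colsub (fun j : 'I_#|I| => enum_val j) A.

Definition full_column_rank I : bool := \rank (col_submx I) == #|I|.

Definition calB : {set {set 'I_n}} :=
  [set I | full_column_rank I && ((col_submx I)^T *m b != 0)]%SET.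

Definition ls_solution I : 'cV[R]_#|I| :=
  invmx ((col_submx I)^T *m col_submx I) *m ((col_submx I)^T *m b).

Definition delta_of I : \bar R :=
  \big[mine/+oo%E]_(i < #|I| | 0 < `|ls_solution I i 0|)
    (`|ls_solution I i 0|)%:E.

Definition delta : \bar R := \big[mine/+oo%E]_(I in calB) delta_of I.

End Delta.

(* Main.v *)
Require Import Defs.
From mathcomp Require Import all_boot all_order all_algebra.
From mathcomp Require Import all_classical all_reals all_analysis.
From mathcomp Require Import lra.
Import Order.TTheory GRing.Theory Num.Theory.
Import numFieldNormedType.Exports.
Set Implicit Arguments.
Unset Strict Implicit.
Unset Printing Implicit Defensive.
Local Open Scope classical_set_scope.
Local Open Scope ring_scope.

(** The penalty of a local minimizer x with more than r nonzero entries is the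
sum of phi (|x_j|) over a set S of n - r indices carrying the smallest entries,
and since phi is increasing this set realises the minimum of the same sum over
all index sets of that size.  Hence the objective lies everywhere below the sum
over S and touches it at x.

Let h lie in the kernel of A with support inside that of x.  On a short segment
x + t h no nonzero entry changes sign, so each phi (|x_j + t h_j|) is concave in
t, strictly if h_j <> 0.  If h_j <> 0 for some j in S, then the mean of the
objective at x + t h and x - t h is strictly below its value at x, against local
minimality.  So every such h vanishes on S ([kernel_vanishes_on_tail]).

This does not make the columns of A on the support of x independent: h may live
on the r largest entries, where the objective does not see it.  But
subtracting kernel vectors from x, always killing one more entry, leads to a
solution z of A z = b supported inside the support of x, whose columns are
independent ([exists_full_rank_reduction]).  Because z - x is a kernel vector of
the kind considered above, z and x agree on S.  Since x has more than r nonzero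
entries, S contains an index i0 at which |x| attains its least nonzero value.
The nonzero entries of z are the least-squares coefficients of its support, and
so delta <= |z_i0| = |x_i0| <= |x_i| for every nonzero x_i.

In case (i) every solution, hence x, has at least K > r nonzero entries; in
case (ii) x is r-sparse or has more than r nonzero entries. *)

(** * Strict concavity of the penalty *)

(** Two applications of the mean value theorem to phi express the one-sided
increments through phi' at points on either side of a; a third one, to phi',
compares these two slopes. *)
Lemma midpoint_strict_concave (R : realType) (phi : R -> R) :
  negative_second_derivative phi ->
  forall a d : R, 0 < d -> d < a -> phi (a + d) + phi (a - d) < phi a *+ 2.
Proof.
move=> phi_dd a d d0 da.
have slope (f : R -> R) (u v : R) : 0 < u -> u < v ->
    (forall t, 0 < t -> derivable f t 1) ->
    exists c, [/\ u < c, c < v & f v - f u = derive1 f c * (v - u)].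
  move=> u0 uv df.
  have [||c] := @MVT R f (derive1 f) u v uv.
  - move=> t; rewrite in_itv /= => /andP[ut _].
    by rewrite derive1E; apply/derivableP/df/(lt_trans u0).
  - apply: derivable_within_continuous => t; rewrite in_itv /= => /andP[ut _].
    exact/df/(lt_le_trans u0).
  - by rewrite in_itv /= => /andP[uc cv] ->; exists c.
have dphi t : 0 < t -> derivable phi t 1 by case/phi_dd.
have dphi1 t : 0 < t -> derivable (derive1 phi) t 1 by case/phi_dd.
have [|||c2 [ac2 c2d E2]] := slope phi (a - d) a; rewrite ?subr_gt0 //; first lra.
have [|||c1 [ac1 c1d E1]] := slope phi a (a + d); rewrite //; [lra | lra |].
have [|||c [c2c _ Ec]] := slope (derive1 phi) c2 c1; rewrite //; [lra | lra |].
have [|_ _ dd] := phi_dd c; first by lra.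
have: derive1 (derive1 phi) c * (c1 - c2) < 0 by rewrite nmulr_rlt0 // subr_gt0; lra.
rewrite -Ec subr_lt0 => lt12.
have: derive1 phi c1 * d < derive1 phi c2 * d by rewrite ltr_pM2r.
move: E1 E2; rewrite [a + d]addrC addrK opprB addrCA subrr addr0 => <-.
rewrite mulr2n; lra.
Qed.

(** Small perturbations keep the sign, so the absolute value is affine there. *)
Lemma norm_add_small (R : realDomainType) (a d : R) : `|d| < `|a| ->
  `|a + d| = `|a| + Num.sg a * d.
Proof.
move=> da; have [a0|a0|a0] := ltrgt0P a.
- move: da; rewrite (gtr0_norm a0) ltr_norml => /andP[? ?].
  by rewrite gtr0_norm ?gtr0_sg ?mul1r //; lra.
- move: da; rewrite (ltr0_norm a0) ltr_norml => /andP[? ?].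
  by rewrite ltr0_norm ?ltr0_sg //; lra.
- by move: da; rewrite a0 normr0 normr_lt0.
Qed.

Lemma penalty_midpoint_lt (R : realType) (phi : R -> R) (a d : R) :
  negative_second_derivative phi -> `|d| < `|a| -> d != 0 ->
  phi `|a + d| + phi `|a - d| < phi `|a| *+ 2.
Proof.
move=> phi_dd da d0; rewrite !norm_add_small ?normrN // mulrN.
wlog: d da d0 / 0 < Num.sg a * d => [IH|].
  have a0 : a != 0 by rewrite -normr_gt0 (le_lt_trans _ da).
  have : Num.sg a * d != 0 by rewrite mulf_neq0 // sgr_eq0.
  rewrite neq_lt => /orP[s0|]; last exact: IH.
  have := IH (- d); rewrite normrN oppr_eq0 !mulrN opprK addrC.
  by apply; rewrite // oppr_gt0.
move=> s0; apply: midpoint_strict_concave => //.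
apply: le_lt_trans da; apply: le_trans (ler_norm _) _.
by rewrite normrM normr_sg; case: (a != 0); rewrite ?mul1r // mul0r.
Qed.

(** * The penalty as a minimum over index sets *)

(** Cancel the common indices: what remains are two sets of equal size, and the
largest value on S separates them. *)
Lemma sum_smallest_le (R : realDomainType) (T : finType) (g : T -> R)
    (S S' : {set T}) :
  #|S| = #|S'| -> (forall k j, k \in S -> j \notin S -> g k <= g j) ->
  \sum_(k in S) g k <= \sum_(k in S') g k.
Proof.
move=> cardS Sle; have [S0|[k0 k0S]] := set_0Vmem S.
  by move: cardS; rewrite S0 cards0 => /esym/cards0_eq ->; rewrite !big_set0.
pose k1 := [arg max_(k > k0 in S) g k]%O.
have [k1S k1max] : k1 \in S /\ forall k, k \in S -> g k <= g k1.
  by rewrite /k1; case: arg_maxP => // k kS kmax; split=> // ? /kmax.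
rewrite (big_setID S') [leRHS](big_setID S) /= finset.setIC lerD2l.
have eqD : #|S :\: S'| = #|S' :\: S|.
  by rewrite !cardsD cardS [S' :&: S]finset.setIC.
apply: (@le_trans _ _ (\sum_(k in S :\: S') g k1)).
  by apply: ler_sum => k /setDP[kS _]; exact: k1max.
rewrite sumr_const eqD -sumr_const.
by apply: ler_sum => j /setDP[_ jS]; exact: Sle.
Qed.

(** Sorting the indices instead of the values turns the trailing part of the
sorted sequence into a set S of indices.  The last clause is weak because of
ties: S is one of possibly several such sets. *)
Lemma tail_penalty_selection (R : realType) (n r : nat) (phi : R -> R)
    (y : 'cV[R]_n) :
  exists S : {set 'I_n},
    [/\ #|S| = (n - r)%N,
        tail_penalty phi r y = \sum_(j in S) phi `|y j 0| &
        forall k j, k \in S -> j \notin S -> `|y k 0| <= `|y j 0|].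
Proof.
pose f (j : 'I_n) := `|y j 0|.
pose ge : rel R := fun a c => c <= a.
pose p := sort (relpre f ge) (enum 'I_n).
have ge_total : total (relpre f ge) by move=> i j; exact: le_total.
have ge_trans : transitive (relpre f ge) by move=> i j k /= ij jk; exact: le_trans jk ij.
have p_perm : perm_eq p (enum 'I_n) by rewrite perm_sort.
have p_uniq : uniq p by rewrite (perm_uniq p_perm) enum_uniq.
have p_size : size p = n by rewrite (perm_size p_perm) size_enum_ord.
have p_mem j : j \in p by rewrite (perm_mem p_perm) mem_enum.
exists [set j in drop r p]%SET; split.
- by rewrite cardsE (card_uniqP _) ?size_drop ?p_size // drop_uniq.
- rewrite /tail_penalty big_add1 /= /abs_largest /=.
  rewrite (_ : sort _ _ = map f p); last by rewrite sort_map.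
  transitivity (\sum_(j <- drop r p) phi (f j)).
    rewrite -[in RHS](big_map f predT) map_drop [RHS](big_nth 0).
    rewrite size_drop size_map p_size -{1}[r]add0n big_addn.
    by apply: eq_bigr => i _; rewrite nth_drop addnC.
  rewrite big_uniq ?drop_uniq //=.
  by apply: eq_bigl => j; rewrite inE.
- move=> k j; rewrite !inE => kS jS.
  have: sorted (relpre f ge) p by exact: sort_sorted.
  rewrite sorted_pairwise // -{1}(cat_take_drop r p) pairwise_cat.
  case/andP=> /allrelP ge_td _; apply: ge_td => //.
  by move: (p_mem j); rewrite -{1}(cat_take_drop r p) mem_cat (negPf jS) orbF.
Qed.

Lemma tail_penalty_le (R : realType) (n r : nat) (phi : R -> R)
    (y : 'cV[R]_n) (S : {set 'I_n}) :
  {in `[0, +oo[ &, {homo phi : s t / s <= t}} -> #|S| = (n - r)%N ->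
  tail_penalty phi r y <= \sum_(j in S) phi `|y j 0|.
Proof.
move=> phi_incr cardS; have [S0 [cardS0 -> S0le]] := tail_penalty_selection r phi y.
apply: sum_smallest_le => [|k j kS jS]; first by rewrite cardS0.
by apply: phi_incr; rewrite ?in_itv ?andbT //=; exact: S0le.
Qed.

(** * Kernel directions at a local minimizer *)

Lemma exists_small_scaling (R : realFieldType) (T : finType) (h c : T -> R) :
  (forall j, 0 < c j) -> exists2 t, 0 < t & forall j, t * `|h j| < c j.
Proof.
move=> c0; pose t := \big[Order.min/1]_j (c j / (1 + `|h j|)).
have h1 j : 0 < 1 + `|h j| by rewrite ltr_pwDl.
exists t => [|j]; first by apply: lt_bigmin => // j _; rewrite divr_gt0.
have tj : t <= c j / (1 + `|h j|) by exact: bigmin_le.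
have: t * (1 + `|h j|) <= c j by rewrite -ler_pdivlMr.
have: 0 < t by apply: lt_bigmin => // k _; rewrite divr_gt0.
rewrite mulrDr mulr1 => ? ?; lra.
Qed.

Definition vsupp (R : nmodType) (n : nat) (y : 'cV[R]_n) : {set 'I_n} :=
  [set i | y i 0 != 0]%SET.

(** Otherwise the objective at x + t h and x - t h would, for a small t > 0,
average strictly below its value at x.  The set S of smallest entries of x need
not consist of the smallest entries of x + t h, but by [tail_penalty_le] the sum
over S still bounds the objective from above. *)
Lemma kernel_vanishes_on_tail (R : realType) (m n r : nat) (A : 'M[R]_(m, n))
    (b : 'cV[R]_m) (phi : R -> R) (x h : 'cV[R]_n) (S : {set 'I_n}) :
  {in `[0, +oo[ &, {homo phi : s t / s <= t}} ->
  negative_second_derivative phi ->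
  local_minimizer (tail_penalty phi r) [set y | A *m y - b = 0] x ->
  #|S| = (n - r)%N -> tail_penalty phi r x = \sum_(j in S) phi `|x j 0| ->
  A *m h = 0 -> vsupp h \subset vsupp x ->
  forall j, j \in S -> h j 0 = 0.
Proof.
move=> phi_incr phi_dd [Ax xmin] cardS tailx Ah hx j0 j0S.
apply/eqP; apply/negP => /negP hj0.
have hx0 j : x j 0 = 0 -> h j 0 = 0.
  move=> xj; apply/eqP; apply/negPn; apply/negP => hj.
  by have /(fintype.subsetP hx) : j \in vsupp h; rewrite inE ?hj // xj eqxx.
have /nbhs_ballP[e /= e0 xe] := xmin.
(* The bound e keeps x + t h in the neighbourhood; the bound |x_j| keeps the
   sign of the nonzero entries. *)
pose c j := if x j 0 == 0 then e else Num.min e `|x j 0|.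
have [|t t0 tc] := @exists_small_scaling R _ (fun j => h j 0) c.
  by move=> j; rewrite /c; case: eqVneq => // xj; rewrite lt_min e0 normr_gt0.
have te j : `|t * h j 0| < e.
  rewrite normrM (gtr0_norm t0); apply: lt_le_trans (tc j) _.
  by rewrite /c; case: ifP => // _; rewrite ge_min lexx.
have tx j : x j 0 != 0 -> `|t * h j 0| < `|x j 0|.
  rewrite normrM (gtr0_norm t0) => xj; apply: lt_le_trans (tc j) _.
  by rewrite /c (negPf xj) ge_min lexx orbT.
have near_le s : `|s| = t ->
    tail_penalty phi r x <= \sum_(j in S) phi `|x j 0 + s * h j 0|.
  move=> st; apply: (@le_trans _ _ (tail_penalty phi r (x + s *: h))).
    apply: xe; last by rewrite /= mulmxDr -scalemxAr Ah scaler0 addr0.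
    split=> // i j; rewrite /ball /= !mxE (ord1 j) opprD addNKr normrN.
    by rewrite normrM st -(gtr0_norm t0) -normrM.
  apply: le_trans (tail_penalty_le (x + s *: h) phi_incr cardS) _.
  by apply: ler_sum => j _; rewrite !mxE.
have := lerD (near_le t (gtr0_norm t0)) (near_le (- t) _).
rewrite normrN (gtr0_norm t0) tailx => /(_ erefl).
apply/negP; rewrite -ltNge -!big_split /=.
rewrite (bigD1 j0) //= [ltRHS](bigD1 j0) //= ltr_leD //.
  rewrite mulNr -mulr2n; apply: penalty_midpoint_lt => //.
    by apply: tx; apply: contra hj0 => /eqP /hx0 ->.
  by rewrite mulf_neq0 // gt_eqF.
apply: ler_sum => j _; have [hj|hj] := eqVneq (h j 0) 0.
  by rewrite hj !mulr0 addr0.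
rewrite mulNr -mulr2n; apply/ltW/penalty_midpoint_lt => //.
  by apply: tx; apply: contra hj => /eqP /hx0 ->.
by rewrite mulf_neq0 // gt_eqF.
Qed.

(** * Solutions with independent columns *)

Lemma mulmx_supported (R : realType) (m n : nat) (A : 'M[R]_(m, n))
    (y : 'cV[R]_n) (I : {set 'I_n}) : vsupp y \subset I ->
  A *m y = col_submx A I *m rowsub (fun k : 'I_#|I| => enum_val k) y.
Proof.
move=> yI; apply/matrixP => i k; rewrite !mxE (bigID (mem I)) /=.
rewrite [X in _ + X]big1 ?addr0 => [|j jI].
  by rewrite big_enum_val; apply: eq_bigr => l _; rewrite !mxE.
have : j \notin vsupp y by apply: contra jI; exact/fintype.subsetP.
by rewrite inE negbK (ord1 k) => /eqP ->; rewrite mulr0.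
Qed.

Lemma kernel_of_not_full_column_rank (R : realType) (m n : nat)
    (A : 'M[R]_(m, n)) (I : {set 'I_n}) : ~~ full_column_rank A I ->
  exists h : 'cV[R]_n, [/\ h != 0, A *m h = 0 & vsupp h \subset I].
Proof.
rewrite /full_column_rank -mxrank_tr => /negP nfull.
have [v] : exists v : 'rV_#|I|, v *m (col_submx A I)^T = 0 /\ v != 0.
  apply: contra_notP nfull => nv; apply: inj_row_free => v vA.
  by have [//|v0] := eqVneq v 0; case: nv; exists v.
case=> vA v0; pose E : 'M[R]_(n, #|I|) := colsub (fun k => enum_val k) 1%:M.
pose h := E *m v^T.
have hI : vsupp h \subset I.
  apply/fintype.subsetP => j; rewrite inE; apply: contraR => jI; rewrite mxE.
  apply/eqP; apply: big1 => k _; rewrite !mxE.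
  have [jk|_] := eqVneq j (enum_val k); last by rewrite mul0r.
  by move: jI; rewrite jk enum_valP.
have hE : rowsub (fun k : 'I_#|I| => enum_val k) h = v^T.
  rewrite /h -mul_rowsub_mx -[RHS]mul1mx; congr (_ *m _).
  by apply/matrixP => k l; rewrite !mxE (inj_eq enum_val_inj).
exists h; split => //.
  apply: contra_neq v0 => h0; rewrite -[v]trmxK -hE h0.
  by apply/matrixP => k l; rewrite !mxE.
by rewrite (mulmx_supported A hI) hE -[_ *m _]trmxK trmx_mul trmxK vA trmx0.
Qed.

(** If v B^T B = 0 then the squared norm v B^T B v^T of v B^T vanishes; the field
being real, so does v B^T, and then v by independence. *)
Lemma gram_unitmx (R : realFieldType) (m k : nat) (B : 'M[R]_(m, k)) :
  \rank B = k -> B^T *m B \in unitmx.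
Proof.
move=> rkB; rewrite -row_free_unit; apply: inj_row_free => v vBB.
have BT_free : row_free B^T by rewrite /row_free mxrank_tr rkB.
suff vB : v *m B^T = 0 by apply: (row_free_inj BT_free); rewrite mul0mx.
have : (v *m B^T) *m (v *m B^T)^T = 0.
  by rewrite trmx_mul trmxK mulmxA -[v *m _ *m _]mulmxA vBB mul0mx.
move/matrixP/(_ 0 0); rewrite !mxE => /eqP.
rewrite psumr_eq0 => [/allP sq0|j _]; last by rewrite [_^T _ _]mxE -expr2 sqr_ge0.
apply/matrixP => i j; rewrite (ord1 i) [RHS]mxE.
have := sq0 j (mem_index_enum _).
by rewrite [_^T _ _]mxE -expr2 sqrf_eq0 => /eqP.
Qed.

(** When the columns on the support of y are independent, y restricted to its
support is the unique solution of the normal equations, so it is one of the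
vectors over which delta is minimised.  The support belongs to the family calB
because A_I^T b = A_I^T A_I y_I is the image of a nonzero vector under an
invertible matrix. *)
Lemma delta_le_entry (R : realType) (m n : nat) (A : 'M[R]_(m, n))
    (b : 'cV[R]_m) (y : 'cV[R]_n) (i : 'I_n) :
  A *m y = b -> full_column_rank A (vsupp y) -> y i 0 != 0 ->
  (delta A b <= `|y i 0|%:E)%E.
Proof.
move=> Ay full yi; set I := vsupp y in full.
pose yI := rowsub (fun k : 'I_#|I| => enum_val k) y.
have AyI : col_submx A I *m yI = b by rewrite -mulmx_supported.
have gramU := gram_unitmx (eqP full).
have lsE : ls_solution A b I = yI.
  by rewrite /ls_solution -AyI [_ *m (_ *m yI)]mulmxA mulKmx.
have iI : i \in I by rewrite inE.
pose k := enum_rank_in iI i.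
have yk : yI k 0 = y i 0 by rewrite mxE enum_rankK_in.
apply: (@bigmin_inf _ _ _ _ I) => //.
  rewrite inE full /= -AyI mulmxA.
  apply: contra_neq yi => /(congr1 (mulmx (invmx ((col_submx A I)^T *m col_submx A I)))).
  by rewrite mulKmx // mulmx0 -yk => ->; rewrite mxE.
apply: (@bigmin_inf _ _ _ _ k); rewrite lsE yk //.
by rewrite normr_gt0.
Qed.

(** A kernel vector supported inside the support of y allows one to cancel an
entry of y without creating new ones; iterate until no such vector is left. *)
Lemma exists_full_rank_reduction (R : realType) (m n : nat) (A : 'M[R]_(m, n))
    (y : 'cV[R]_n) :
  exists z : 'cV[R]_n, [/\ A *m z = A *m y, vsupp z \subset vsupp y &
    full_column_rank A (vsupp z)].
Proof.
have [N] := ubnP #|vsupp y|; elim: N y => // N IH y yN.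
have [full|/kernel_of_not_full_column_rank[h [h0 Ah hy]]] :=
  boolP (full_column_rank A (vsupp y)); first by exists y.
have [j hj] : exists j, h j 0 != 0.
  apply/existsP; apply: contraNT h0; rewrite negb_exists => /forallP h0.
  by apply/eqP/matrixP => i k; rewrite (ord1 k) mxE; apply/eqP/negPn/h0.
pose z := y - (y j 0 / h j 0) *: h.
have Az : A *m z = A *m y by rewrite mulmxBr -scalemxAr Ah scaler0 subr0.
have zy : vsupp z \proper vsupp y.
  apply/properP; split; last first.
    exists j; first by apply: (fintype.subsetP hy); rewrite inE.
    by rewrite inE !mxE divfK // subrr eqxx.
  apply/fintype.subsetP => i; rewrite !inE !mxE; apply: contra => /eqP yi.
  suff -> : h i 0 = 0 by rewrite yi mulr0 subr0.
  apply/eqP/negPn/negP => hi.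
  by have /(fintype.subsetP hy) : i \in vsupp h; rewrite inE ?hi // yi eqxx.
have [|w [Aw wz full]] := IH z.
  by apply: leq_trans (proper_card zy) _.
exists w; split=> //; first by rewrite Aw.
exact: fintype.subset_trans wz (proper_sub zy).
Qed.

(** * The lower bound at local minimizers *)

(** The index set S of the tail has n - r elements and the support of x more
than r, so they meet; the least entry of x on the intersection is the least
nonzero entry of x.  It is untouched when x is reduced to a solution z with
independent columns, and the bound for the entries of z applies to it. *)
Lemma delta_le_local_minimizer (R : realType) (m n r : nat) (A : 'M[R]_(m, n))
    (b : 'cV[R]_m) (phi : R -> R) (x : 'cV[R]_n) :
  {in `[0, +oo[ &, {homo phi : s t / s <= t}} ->
  negative_second_derivative phi ->
  local_minimizer (tail_penalty phi r) [set y | A *m y - b = 0] x ->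
  (r < l0norm x)%N ->
  forall i, x i 0 != 0 -> (delta A b <= `|x i 0|%:E)%E.
Proof.
move=> phi_incr phi_dd xmin rx i xi.
have [S [cardS tailx Sle]] := tail_penalty_selection r phi x.
have [j0 j0x] : exists j, j \in vsupp x :&: S.
  apply/set0Pn; apply: contraL rx; rewrite finset.setI_eq0 -leqNgt => disj.
  have /subset_leq_card : vsupp x \subset ~: S by rewrite -finset.disjoints_subset.
  rewrite [leqRHS]cardsCs finset.setCK cardS card_ord => /leq_trans; apply.
  by rewrite leq_subLR addnC -leq_subLR.
pose i0 := [arg min_(j < j0 in vsupp x :&: S) `|x j 0|]%O.
have [xi0 i0S i0min] : [/\ x i0 0 != 0, i0 \in S &
    forall j, x j 0 != 0 -> `|x i0 0| <= `|x j 0|].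
  rewrite /i0; case: arg_minP => // k; rewrite inE => /andP[kx kS] kmin.
  split=> // [|j xj]; first by rewrite inE in kx.
  have [jS|jS] := boolP (j \in S); last exact: Sle.
  by apply: kmin; rewrite !inE xj.
have [z [Az zx full]] := exists_full_rank_reduction A x.
have Ax : A *m x = b by apply/subr0_eq; case: xmin.
have zi0 : z i0 0 = x i0 0.
  have := @kernel_vanishes_on_tail _ _ _ r A b phi x (z - x) S phi_incr phi_dd
    xmin cardS tailx.
  rewrite mulmxBr Az subrr => /(_ erefl) zx0.
  apply/subr0_eq; have := zx0 _ i0 i0S; rewrite !mxE; apply.
  apply/fintype.subsetP => j; rewrite !inE !mxE; apply: contraNneq => xj.
  rewrite xj subr0; apply: contraT => zj.
  by have /(fintype.subsetP zx) : j \in vsupp z; rewrite inE // xj eqxx.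
apply: le_trans (_ : `|z i0 0|%:E <= _)%E; last by rewrite lee_fin zi0 i0min.
by apply: delta_le_entry; rewrite ?Az ?zi0.
Qed.

Theorem theorem3p2 (R : realType) (m n : nat) (A : 'M[R]_(m, n)) (b : 'cV[R]_m)
    (r : nat) (hr : (r < n)%N) (phi : R -> R)
    (phi_lsc : lsc_on_nonneg phi)
    (phi_incr : {in `[0, +oo[ &, {homo phi : s t / s <= t}})
    (phi0 : phi 0 = 0)
    (phi_dd : negative_second_derivative phi)
    (x : 'cV[R]_n)
    (hx : local_minimizer (tail_penalty phi r) [set y : 'cV[R]_n | A *m y - b = 0] x)
    (K : nat)
    (hK : is_minimum [set l0norm y | y in [set y : 'cV[R]_n | A *m y = b]] K) :
  ((r < K)%N ->
     forall i : 'I_n, x i 0 != 0 -> (delta A b <= (`|x i 0|)%:E)%E) /\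
  ((K <= r)%N ->
     (l0norm x <= r)%N \/
     forall i : 'I_n, x i 0 != 0 -> (delta A b <= (`|x i 0|)%:E)%E).
Proof.
split=> [rK|_].
  apply: (delta_le_local_minimizer phi_incr phi_dd hx).
  apply: leq_trans rK _; apply: hK.2; exists x => //=.
  by apply/subr0_eq; case: hx.
have [xr|rx] := leqP (l0norm x) r; first by left.
by right; exact: (delta_le_local_minimizer phi_incr phi_dd hx).
Qed.
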